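(* Let $n\ge 1$, let $A\subset\mathbb{R}^n$ be a nonempty and closed set, and let $r>0$. Then $A$ is $r$-strongly convex if and only if $A$ is convex, bounded, and $r$-negatively $\mathcal{E}_r(A)$-convex, where $\mathcal{E}_r(A):=\{x\in\mathbb{R}^n : \sup_{a\in A}\|x-a\|>r\}$.
   Context: $\|\cdot\|$ and $\langle\cdot,\cdot\rangle$ are the Euclidean norm and inner product on $\mathbb{R}^n$; $\operatorname{bdry}A$ is the topological boundary of $A$. Proximal normal cone: for $A$ nonempty and closed and $a\in A$, $N_A^P(a):=\{\zeta\in\mathbb{R}^n : \exists\,\sigma\ge 0,\ \langle\zeta,x-a\rangle\le\sigma\|x-a\|^2\ \text{for all }x\in A\}$. $r$-strongly convex: $A$ is the intersection of a nonempty family of closed balls of $\mathbb{R}^n$, all of the same radius $r$. Negative normal segment to $A$ at $a\in\operatorname{bdry}A$: a segment $[a,a-t\zeta]$ with $\zeta\in N_A^P(a)$ a unit vector and $t\ge 0$; its length is $t$ and its endpoint is $a-t\zeta$. $r$-negatively $S$-convex (for $S\subset\mathbb{R}^n$): no point of $S$ is the endpoint of two negative normal segments to $A$ at two different boundary points of $A$ with both lengths greater than $r$. That is, there do not exist $x\in S$, distinct $a,a'\in\operatorname{bdry}A$, unit vectors $\zeta\in N_A^P(a)$, $\zeta'\in N_A^P(a')$, and $t,t'>r$ with $x=a-t\zeta=a'-t'\zeta'$. *)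

(* Defs.v *)
From mathcomp Require Import all_boot all_order all_algebra.
From mathcomp Require Import all_classical all_reals all_analysis.

Set Implicit Arguments.
Unset Strict Implicit.
Unset Printing Implicit Defensive.

Import Order.TTheory GRing.Theory Num.Theory.
Import numFieldNormedType.Exports.

Local Open Scope classical_set_scope.
Local Open Scope ring_scope.

(* The library norm `|x| on 'rV[R]_n is the sup norm, so the Euclidean inner
   product and norm are defined here; the topology of 'rV[R]_n and its bounded
   sets are the same for the two norms. *)

Definition dotv (R : realType) (n : nat) (u v : 'rV[R]_n) : R :=
  \sum_(i < n) u 0 i * v 0 i.

Definition enorm (R : realType) (n : nat) (u : 'rV[R]_n) : R :=
  Num.sqrt (dotv u u).

Definition eclosed_ball (R : realType) (n : nat) (c : 'rV[R]_n) (r : R) :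
    set 'rV[R]_n :=
  [set x | enorm (x - c) <= r].

Definition bdry (T : topologicalType) (A : set T) : set T :=
  closure A `\` interior A.

Definition prox_normal (R : realType) (n : nat) (A : set 'rV[R]_n)
    (a : 'rV[R]_n) : set 'rV[R]_n :=
  [set z | exists2 sigma : R, 0 <= sigma &
     forall x, A x -> dotv z (x - a) <= sigma * enorm (x - a) ^+ 2].

(* A family of balls of radius r is given by its set C of centers. *)
Definition strongly_convex (R : realType) (n : nat) (r : R)
    (A : set 'rV[R]_n) : Prop :=
  exists2 C : set 'rV[R]_n, C !=set0 & A = \bigcap_(c in C) eclosed_ball c r.

(* [a, x] is a negative normal segment to A at a, of length t. *)
Definition neg_normal_segment (R : realType) (n : nat) (A : set 'rV[R]_n)
    (a : 'rV[R]_n) (t : R) (x : 'rV[R]_n) : Prop :=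
  [/\ bdry A a, 0 <= t &
      exists z, [/\ prox_normal A a z, enorm z = 1 & x = a - t *: z]].

Definition neg_convex (R : realType) (n : nat) (r : R) (S A : set 'rV[R]_n) :
    Prop :=
  ~ exists (x a a' : 'rV[R]_n) (t t' : R),
      [/\ S x, a <> a', r < t /\ r < t',
          neg_normal_segment A a t x & neg_normal_segment A a' t' x].

(* The supremum is taken in \bar R: it is +oo when A is unbounded. *)
Definition excess_set (R : realType) (n : nat) (r : R) (A : set 'rV[R]_n) :
    set 'rV[R]_n :=
  [set x | (r%:E < ereal_sup [set (enorm (x - a))%:E | a in A])%E].

(* Main.v *)
Require Import Defs.
From mathcomp Require Import all_boot all_order all_algebra.
From mathcomp Require Import all_classical all_reals all_analysis.
From mathcomp Require Import ring lra.

(* If A is an intersection of balls of radius r, then for a, b in A the ball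
   around k b + (1 - k) a of radius k (1 - k) |b - a|^2 / (2 r) lies in A. Testing
   a unit normal z at a against the point of this ball in direction z and letting
   k -> 0 gives <z, b - a> <= - |b - a|^2 / (2 r): A lies in the ball of radius r
   centred at a - r z. Hence a is strictly farther from a - t z (t > r) than any
   other point of A, so two long negative normal segments with a common endpoint
   would each have to be the longer one.

   Conversely, if A is not contained in the ball of radius r centred at a - r z,
   then for some t > r the point x = a - t z satisfies |x - b| > t for some b in A.
   The segment from x to the point of A farthest from x is then a second long
   negative normal segment. So all these balls contain A, and taking for a the
   projection of an outside point, they separate A from its complement. *)

Import Order.TTheory GRing.Theory Num.Theory.
Import numFieldNormedType.Exports.

Local Open Scope classical_set_scope.
Local Open Scope ring_scope.

Section Euclidean.
Context {R : realType} {n : nat}.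
Implicit Types (u v w x a b c z : 'rV[R]_n) (k r t : R).

(** * Euclidean inner product and norm *)

Lemma dotvC u v : dotv u v = dotv v u.
Proof. by apply: eq_bigr => i _; rewrite mulrC. Qed.

Lemma dotvDl u v w : dotv (u + v) w = dotv u w + dotv v w.
Proof. by rewrite -big_split; apply: eq_bigr => i _; rewrite mxE mulrDl. Qed.

Lemma dotvZl k u w : dotv (k *: u) w = k * dotv u w.
Proof. by rewrite /dotv mulr_sumr; apply: eq_bigr => i _; rewrite mxE mulrA. Qed.

Lemma dotvDr u v w : dotv w (u + v) = dotv w u + dotv w v.
Proof. by rewrite !(dotvC w) dotvDl. Qed.

Lemma dotvZr k u w : dotv w (k *: u) = k * dotv w u.
Proof. by rewrite !(dotvC w) dotvZl. Qed.

Lemma dotv_ge0 u : 0 <= dotv u u.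
Proof. by apply: sumr_ge0 => i _; rewrite -expr2 sqr_ge0. Qed.

Lemma enorm_ge0 u : 0 <= enorm u.
Proof. exact: sqrtr_ge0. Qed.

Lemma sqr_enorm u : enorm u ^+ 2 = dotv u u.
Proof. by rewrite sqr_sqrtr ?dotv_ge0. Qed.

Lemma enorm_le u k : 0 <= k -> (enorm u <= k) = (dotv u u <= k ^+ 2).
Proof. by move=> k0; rewrite -sqr_enorm ler_sqr ?nnegrE ?enorm_ge0. Qed.

Lemma enorm_lt u k : 0 <= k -> (k < enorm u) = (k ^+ 2 < dotv u u).
Proof. by move=> k0; rewrite ltNge enorm_le// -ltNge. Qed.

Lemma dotv_sqrD u v :
  dotv (u + v) (u + v) = dotv u u + 2 * dotv u v + dotv v v.
Proof. by rewrite !dotvDl !dotvDr (dotvC v u); ring. Qed.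

Lemma dotv_sqrZ k u : dotv (k *: u) (k *: u) = k ^+ 2 * dotv u u.
Proof. by rewrite dotvZl dotvZr; ring. Qed.

(** The uniform convexity of the squared norm, with its exact defect; this defect makes room for the
    small balls inside [A]. *)
Lemma dotv_sqr_conv k u v :
  dotv (k *: u + (1 - k) *: v) (k *: u + (1 - k) *: v) =
  k * dotv u u + (1 - k) * dotv v v - k * (1 - k) * dotv (u - v) (u - v).
Proof.
by rewrite -(scaleN1r v) !dotv_sqrD !dotv_sqrZ !(dotvZl, dotvZr); ring.
Qed.

Lemma enormZ k u : enorm (k *: u) = `|k| * enorm u.
Proof. by rewrite /enorm dotv_sqrZ sqrtrM ?sqr_ge0// sqrtr_sqr. Qed.

Lemma enormB u v : enorm (u - v) = enorm (v - u).
Proof. by rewrite -opprB -scaleN1r enormZ normrN1 mul1r. Qed.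

(** * Comparison with the sup norm, continuity, extremal points *)

Lemma ler_coord_enorm u i : `|u 0 i| <= enorm u.
Proof.
rewrite -sqrtr_sqr ler_sqrt ?dotv_ge0// /dotv (bigD1 i)//= -expr2 lerDl.
by apply: sumr_ge0 => j _; rewrite -expr2 sqr_ge0.
Qed.

Lemma ler_coord_norm u i : `|u 0 i| <= `|u|.
Proof. rewrite [leRHS]mx_normrE; exact: (le_bigmax _ _ (0, i)). Qed.

Lemma ler_norm_enorm u : `|u| <= enorm u.
Proof.
rewrite [leLHS]mx_normrE; apply/bigmax_leP; split; first exact: enorm_ge0.
by move=> [i j] _ /=; rewrite ord1 ler_coord_enorm.
Qed.

Lemma enorm_gt0 u : u != 0 -> 0 < enorm u.
Proof. by rewrite -normr_gt0 => /lt_le_trans; apply; exact: ler_norm_enorm. Qed.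

Lemma enorm_normalize u : 0 < enorm u -> enorm ((enorm u)^-1 *: u) = 1.
Proof.
by move=> u0; rewrite enormZ ger0_norm ?invr_ge0 ?ltW// mulVf ?gt_eqF.
Qed.

Lemma dotv_diag_continuous : continuous (fun u => dotv u u).
Proof.
move=> u; apply: (@cvg_big _ _ _ _ _ _ _ (nbhs u)) => [|i _].
  exact: add_continuous.
by apply: cvgM; exact: coord_continuous.
Qed.

Lemma enorm_sub_continuous x : continuous (fun u => enorm (x - u)).
Proof.
move=> u.
apply: (@continuous_comp _ _ _ (fun u => dotv (x - u) (x - u)) Num.sqrt).
  2: exact: sqrt_continuous.
apply: (@continuous_comp _ _ _ (fun u => x - u) (fun u => dotv u u)); last first.
  exact: dotv_diag_continuous.
by apply: (@cvgB _ _ _ (nbhs u)); [exact: cvg_cst|exact: cvg_id].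
Qed.

(** The bound [e < 1] keeps [1 - e] positive when the ray runs from a nearest point towards [x]. *)
Lemma interior_ray (A : set 'rV[R]_n) a v :
  interior A a -> exists2 e, 0 < e < 1 & A (a + e *: v).
Proof.
move=> Aa.
have cv : a + e *: v @[e --> (0 : R)^'+] --> a.
  rewrite -[in X in _ --> X](addr0 a) -(scale0r v).
  apply: cvgD; first exact: cvg_cst.
  by apply: cvgZr_tmp; apply: cvg_at_right_filter; exact: cvg_id.
have : \forall e \near (0 : R)^'+, A (a + e *: v) by exact: cv.
move=> Ae; near ((0 : R)^'+) => e; exists e; last by near: e.
by apply/andP; split; near: e; [exact: nbhs_right_gt|exact: nbhs_right_lt].
Unshelve. all: by end_near. Qed.


Lemma ex_farthest (A : set 'rV[R]_n) x :
  A !=set0 -> closed A -> bounded_set A ->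
  exists2 a, A a & forall b, A b -> enorm (x - b) <= enorm (x - a).
Proof.
move=> A0 Acl Abd.
have [a /set_mem Aa Amax] := EVT_max_rV A0 (bounded_closed_compact Abd Acl)
  (continuous_subspaceT (enorm_sub_continuous x)).
by exists a => // b /mem_set; exact: Amax.
Qed.

Lemma ex_nearest (A : set 'rV[R]_n) x :
  A !=set0 -> closed A -> bounded_set A ->
  exists2 a, A a & forall b, A b -> enorm (x - a) <= enorm (x - b).
Proof.
move=> A0 Acl Abd.
have [a /set_mem Aa Amin] := EVT_min_rV A0 (bounded_closed_compact Abd Acl)
  (continuous_subspaceT (enorm_sub_continuous x)).
by exists a => // b /mem_set; exact: Amin.
Qed.

(** * Boundary points and normals from farthest and nearest points *)

(** From an interior point one could move a little further away from [x] inside [A]. *)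
Lemma farthest_bdry (A : set 'rV[R]_n) a x :
  A a -> 0 < enorm (a - x) ->
  (forall b, A b -> enorm (b - x) <= enorm (a - x)) -> bdry A a.
Proof.
move=> Aa ax far; split; first exact: subset_closure.
move=> /(interior_ray A a (a - x))[e /andP[e0 _]] /far.
have -> : a + e *: (a - x) - x = (1 + e) *: (a - x).
  by rewrite scalerDl scale1r addrAC.
by rewrite enormZ gtr0_norm ?addr_gt0// leNgt ltr_pMl// ltrDl e0.
Qed.

Lemma nearest_bdry (A : set 'rV[R]_n) a x :
  A a -> 0 < enorm (x - a) ->
  (forall b, A b -> enorm (x - a) <= enorm (x - b)) -> bdry A a.
Proof.
move=> Aa ax near; split; first exact: subset_closure.
move=> /(interior_ray A a (x - a))[e /andP[e0 e1]] /near.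
have -> : x - (a + e *: (x - a)) = (1 - e) *: (x - a).
  by rewrite scalerBl scale1r opprD addrA.
by rewrite enormZ gtr0_norm ?subr_gt0// leNgt gtr_pMl// gtrBl e0.
Qed.

(** [A] lies in a ball around [x] with [a] on its sphere, hence in the half-space tangent there:
    [sigma = 0] suffices. *)
Lemma farthest_prox_normal (A : set 'rV[R]_n) a x k :
  0 <= k -> (forall b, A b -> enorm (b - x) <= enorm (a - x)) ->
  prox_normal A a (k *: (a - x)).
Proof.
move=> k0 far; exists 0 => // b /far; rewrite mul0r enorm_le ?enorm_ge0//.
rewrite sqr_enorm -(subrKA a b (- x)) (dotv_sqrD (b - a)) dotvZl (dotvC (a - x) (b - a)) => h.
have := dotv_ge0 (b - a); nra.
Qed.

(** Expanding [|x - b|^2] around [a] gives [2 <x - a, b - a> <= |b - a|^2]. *)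
Lemma nearest_prox_normal (A : set 'rV[R]_n) a x k :
  0 <= k -> (forall b, A b -> enorm (x - a) <= enorm (x - b)) ->
  prox_normal A a (k *: (x - a)).
Proof.
move=> k0 near; exists k => // b /near; rewrite enorm_le ?enorm_ge0//.
rewrite !sqr_enorm -(subrKA a x (- b)) -(opprB b a) -(scaleN1r (b - a)).
rewrite (dotv_sqrD (x - a)) dotv_sqrZ !(dotvZl, dotvZr) => h.
have := dotv_ge0 (b - a); nra.
Qed.

(** * From strong convexity to negative convexity *)

(** With [rho] the length of the shift, the convex combination [m] relative to [c] satisfies
    [|m|^2 <= r^2 - 2 r rho <= (r - rho)^2], so a shift by [rho] stays in the ball. *)
Lemma ball_conv_shift r c a b z k :
  0 < r -> 0 <= k <= 1 -> enorm z = 1 ->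
  eclosed_ball c r a -> eclosed_ball c r b ->
  eclosed_ball c r (k *: b + (1 - k) *: a +
    (k * (1 - k) * dotv (b - a) (b - a) / (2 * r)) *: z).
Proof.
rewrite /eclosed_ball /= => r0 /andP[k0 k1] z1.
rewrite !(enorm_le _ _ (ltW r0)) => ac bc.
set rho := _ / _; set m := k *: (b - c) + (1 - k) *: (a - c).
have -> : k *: b + (1 - k) *: a + rho *: z - c = m + rho *: z.
  by rewrite /m !scalerBr !scalerBl !scale1r; apply/rowP => i; rewrite !mxE; ring.
have rho0 : 0 <= rho.
  by rewrite divr_ge0 ?mulr_ge0 ?dotv_ge0 ?subr_ge0// ltW.
have rhoE : 2 * r * rho = k * (1 - k) * dotv (b - a) (b - a).
  by rewrite mulrC divfK// mulf_neq0 ?pnatr_eq0// gt_eqF.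
have mm : dotv m m <= r ^+ 2 - 2 * r * rho.
  rewrite rhoE dotv_sqr_conv (_ : b - c - (a - c) = b - a); last first.
    by apply/rowP => i; rewrite !mxE; ring.
  nra.
have zz : dotv z z = 1 by rewrite -sqr_enorm z1 expr1n.
(* Cauchy-Schwarz against the unit vector z *)
have mz : dotv m z ^+ 2 <= dotv m m.
  have := dotv_ge0 (m + (- dotv m z) *: z).
  by rewrite dotv_sqrD dotv_sqrZ dotvZr zz; nra.
have := dotv_ge0 m => mm0.
(* This makes [r - rho] nonnegative, so that it can be compared with [dotv m z] through squares. *)
have rho_r : rho <= r by nra.
have mz_r : dotv m z <= r - rho.
  have [//|lt] := leP (dotv m z) (r - rho); nra.
rewrite dotv_sqrD dotv_sqrZ dotvZr zz; nra.
Qed.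

(** As [|z| = 1], the conclusion is [|b - (a - r z)| <= r] expanded. *)
Lemma strongly_convex_support r (A : set 'rV[R]_n) a b z :
  0 < r -> strongly_convex r A -> A a -> A b ->
  enorm z = 1 -> prox_normal A a z ->
  2 * r * dotv z (b - a) <= - dotv (b - a) (b - a).
Proof.
move=> r0 [C _ AE] Aa Ab z1 [s s0 nrm].
set d2 := dotv (b - a) (b - a); set p := dotv z (b - a); set q := d2 / (2 * r).
have r2 : 2 * r != 0 by rewrite mulf_neq0 ?pnatr_eq0// gt_eqF.
have qE : 2 * r * q = d2 by rewrite mulrC divfK.
have d20 : 0 <= d2 := dotv_ge0 _.
have q0 : 0 <= q by rewrite divr_ge0// mulr_ge0// ltW.
have zz : dotv z z = 1 by rewrite -sqr_enorm z1 expr1n.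
(* [K] is free of [k] and bounds the error terms left after dividing the normal inequality by
   [k]. *)
pose K := q + s * (d2 + 2 * q * `|p| + q ^+ 2).
have K0 : 0 <= K.
  have qp : 0 <= q * `|p| by rewrite mulr_ge0.
  have q2 := sqr_ge0 q.
  by apply: addr_ge0 => //; apply: mulr_ge0 => //; lra.
(* the normal inequality at the point of A given by ball_conv_shift *)
have small k : 0 < k < 1 -> p + q <= k * K.
  move=> /andP[k0 k1].
  have /nrm : A (k *: b + (1 - k) *: a + (k * (1 - k) * d2 / (2 * r)) *: z).
    move: Aa Ab; rewrite AE => Aa Ab c Cc.
    have k01 : 0 <= k <= 1 by rewrite !ltW.
    exact: ball_conv_shift r0 k01 z1 (Aa c Cc) (Ab c Cc).
  set y := _ - a.
  have -> : y = k *: (b - a) + (k * (1 - k) * q) *: z.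
    by apply/rowP => i; rewrite !mxE /q; ring.
  rewrite sqr_enorm dotvDr !dotvZr zz -/p dotv_sqrD !dotv_sqrZ zz.
  rewrite !(dotvZl, dotvZr) (dotvC (b - a)) -/p -/d2 => h.
  have pa : p <= `|p| := ler_norm p.
  have p0 : 0 <= `|p| := normr_ge0 p.
  have h1 : p + (1 - k) * q <=
      s * (k * (d2 + 2 * (1 - k) * q * p + (1 - k) ^+ 2 * q ^+ 2)).
    rewrite -(ler_pM2l k0); lra.
  have h2 : d2 + 2 * (1 - k) * q * p + (1 - k) ^+ 2 * q ^+ 2 <=
      d2 + 2 * q * `|p| + q ^+ 2.
    apply: lerD.
      rewrite lerD2l; apply: (@le_trans _ _ (2 * (1 - k) * q * `|p|)).
        have q2 : 0 <= (1 - k) * q by apply: mulr_ge0 => //; lra.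
        by apply: ler_wpM2l => //; lra.
      have : 0 <= k * (q * `|p|) by apply: mulr_ge0; [exact: ltW|exact: mulr_ge0].
      lra.
    apply: ler_piMl; first exact: sqr_ge0.
    by apply: exprn_ile1; lra.
  have h3 := ler_wpM2l s0 (ler_wpM2l (ltW k0) h2).
  rewrite /K; lra.
suff : p + q <= 0 by rewrite -(pmulr_rle0 _ r0); lra.
rewrite leNgt; apply/negP => pq.
have pqK : 0 < p + q + K + 1 by lra.
(* One value of [k] replaces the limit: here [p + q <= k * K] would force [p + q + K + 1 <= K]. *)
have := small ((p + q) / (p + q + K + 1)).
rewrite divr_gt0//= ltr_pdivrMr// mul1r => /(_ ltac:(lra)).
rewrite mulrAC ler_pdivlMr//; nra.
Qed.

(** Here [t'^2 = |a' - a|^2 + 2 t p + t^2] with [p = <z, a' - a>]; the support inequality gives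
    [p < 0], and [r < t] then makes [2 t p < - |a' - a|^2]. *)
Lemma strongly_convex_length r (A : set 'rV[R]_n) a a' t t' x :
  0 < r -> closed A -> strongly_convex r A -> a <> a' -> r < t ->
  neg_normal_segment A a t x -> neg_normal_segment A a' t' x -> t' ^+ 2 < t ^+ 2.
Proof.
move=> r0 Acl Asc aa' rt [[Aa _] t0 [z [nz z1 ->]]] [[Aa' _] _ [z' [_ z'1]]].
have cA u : closure A u -> A u by rewrite -((closure_id A).1 Acl).
move=> E.
have {}E : t' *: z' = (a' - a) + t *: z.
  by rewrite -[t *: z](subKr a) E; apply/rowP => i; rewrite !mxE; ring.
have /(congr1 (fun u => dotv u u)) := E.
rewrite dotv_sqrD !dotv_sqrZ -!sqr_enorm z1 z'1 dotvZr (dotvC _ z).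
have := @strongly_convex_support r A a a' z r0 Asc (cA _ Aa) (cA _ Aa') z1 nz.
have : 0 < enorm (a' - a) ^+ 2.
  by rewrite exprn_gt0// enorm_gt0// subr_eq0; apply/eqP => /esym.
rewrite -sqr_enorm; set d := _ ^+ 2; set p := dotv z _ => d0 h.
have p0 : p < 0 by nra.
have : t * p < r * p by rewrite ltr_nM2r.
lra.
Qed.

Lemma strongly_convex_neg_convex r (A S : set 'rV[R]_n) :
  0 < r -> closed A -> strongly_convex r A -> neg_convex r S A.
Proof.
move=> r0 Acl Asc [x [a [a' [t [t' [_ aa' [rt rt'] s s']]]]]].
have := strongly_convex_length r A a a' t t' x r0 Acl Asc aa' rt s s'.
have := strongly_convex_length r A a' a t' t x r0 Acl Asc
  (nesym aa') rt' s' s.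
by move=> /lt_trans h /h; rewrite ltxx.
Qed.

Lemma strongly_convex_convex r (A : set 'rV[R]_n) :
  0 < r -> strongly_convex r A -> convex_set A.
Proof.
move=> r0 [C _ ->] x y k /set_mem Ax /set_mem Ay; apply/mem_set => c Cc.
have := Ax c Cc; have := Ay c Cc; rewrite /eclosed_ball /= !(enorm_le _ _ (ltW r0)).
move=> yc xc; have k0 : 0 <= k%:num by []; have k1 : k%:num <= 1 by [].
have -> : conv k x y - c = k%:num *: (x - c) + (1 - k%:num) *: (y - c).
  have -> : conv k x y = k%:num *: x + (1 - k%:num) *: y by [].
  by apply/rowP => i; rewrite !mxE; ring.
rewrite dotv_sqr_conv.
have : 0 <= k%:num * (1 - k%:num) * dotv (x - c - (y - c)) (x - c - (y - c)).
  by rewrite !mulr_ge0 ?dotv_ge0 ?subr_ge0.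
nra.
Qed.

Lemma strongly_convex_bounded r (A : set 'rV[R]_n) :
  strongly_convex r A -> bounded_set A.
Proof.
move=> [C [c Cc] ->]; exists (r + `|c|).
split=> [|N ltN x /(_ c Cc) xc /=]; first exact: num_real.
apply: le_trans (ltW ltN).
rewrite -[x](subrK c) (le_trans (ler_normD _ _))// lerD2r.
exact: le_trans (ler_norm_enorm _) xc.
Qed.

(** * From negative convexity to strong convexity *)

Lemma neg_convex_ball r (A : set 'rV[R]_n) a z :
  0 < r -> A !=set0 -> closed A -> bounded_set A ->
  neg_convex r (excess_set r A) A ->
  bdry A a -> prox_normal A a z -> enorm z = 1 ->
  A `<=` eclosed_ball (a - r *: z) r.
Proof.
move=> r0 A0 Acl Abd Anc abd nz z1 b Ab; rewrite /eclosed_ball /= leNgt.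
apply/negP => out; apply: Anc.
have zz : dotv z z = 1 by rewrite -sqr_enorm z1 expr1n.
have bE t : b - (a - t *: z) = (b - a) + t *: z.
  by apply/rowP => i; rewrite !mxE; ring.
(* [s] is [|b - (a - r z)|^2 - r^2]. *)
set s := dotv (b - a) (b - a) + 2 * r * dotv (b - a) z.
have s0 : 0 < s.
  move: out; rewrite enorm_lt ?ltW// bE dotv_sqrD dotv_sqrZ dotvZr zz /s; lra.
set p := dotv (b - a) z in s s0.
have p1 : 0 < 2 * `|p| + 1 by rewrite ltr_wpDl// mulr_ge0.
(* With this [e], [|b - x|^2 - t^2 = s + 2 e p >= s - 2 e |p| = e > 0]. *)
pose e := s / (2 * `|p| + 1).
have e0 : 0 < e by rewrite divr_gt0.
have eE : e * (2 * `|p| + 1) = s by rewrite divfK// gt_eqF.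
pose t := r + e; pose x := a - t *: z.
have rt : r < t by rewrite ltrDl.
have t0 : 0 < t := lt_trans r0 rt.
have bx : t < enorm (b - x).
  rewrite enorm_lt ?ltW// bE dotv_sqrD dotv_sqrZ dotvZr zz -/p.
  have : 0 <= e * (`|p| + p).
    apply: mulr_ge0; first exact: ltW.
    by have := lerNnormlW (lexx `|p|); lra.
  by move: eE; rewrite /s /t; lra.
have [a' Aa' far'] := ex_farthest A x A0 Acl Abd.
have far c : A c -> enorm (c - x) <= enorm (a' - x).
  by move=> /far'; rewrite enormB (enormB x a').
have t'E := lt_le_trans bx (far b Ab).
set t' := enorm (a' - x) in far t'E.
have t'0 : 0 < t' := lt_trans t0 t'E.
exists x, a, a', t, t'; split => //.
- apply/ereal_sup_gtP; exists (enorm (x - b))%:E; first by exists b.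
  by rewrite lte_fin enormB (lt_trans rt).
(* The distance from [a] to [x] is exactly [t], while [a'] is farther. *)
- move=> aa'; move: t'E; rewrite /t' -aa' /x subKr enormZ z1 mulr1.
  by rewrite gtr0_norm// ltxx.
- by split => //; exact: lt_trans t'E.
- by split => //; [exact: ltW|exists z].
- split; [exact: farthest_bdry Aa' t'0 far|exact: ltW|].
  exists (t'^-1 *: (a' - x)); split.
  + by apply: farthest_prox_normal; rewrite ?invr_ge0 ?ltW.
  + exact: enorm_normalize.
  + by rewrite scalerA divff ?gt_eqF// scale1r subKr.
Qed.

(** A point with all coordinates [|M| + 2] exceeds the sup-norm bound [|M| + 1]; [1 <= n] provides a
    coordinate. *)
Lemma bounded_ex_notin (A : set 'rV[R]_n) :
  (1 <= n)%N -> bounded_set A -> exists x, ~ A x.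
Proof.
move=> n1 [M [_ AM]]; exists (const_mx (`|M| + 2)).
move=> /(AM (`|M| + 1) ltac:(have := ler_norm M; lra)) /=.
move=> /(le_trans (ler_coord_norm _ (Ordinal n1))).
by rewrite mxE ger0_norm ?addr_ge0//; lra.
Qed.

Lemma neg_convex_strongly_convex r (A : set 'rV[R]_n) :
  (1 <= n)%N -> 0 < r -> A !=set0 -> closed A -> bounded_set A ->
  neg_convex r (excess_set r A) A -> strongly_convex r A.
Proof.
move=> n1 r0 A0 Acl Abd Anc.
have sep x : ~ A x -> exists2 c, A `<=` eclosed_ball c r & ~ eclosed_ball c r x.
  move=> Ax; have [a Aa near] := ex_nearest A x A0 Acl Abd.
  have d0 : 0 < enorm (x - a).
    by rewrite enorm_gt0// subr_eq0; apply/eqP => xa; apply: Ax; rewrite xa.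
  set d := enorm (x - a) in d0; pose z := d^-1 *: (x - a).
  have z1 : enorm z = 1 by exact: enorm_normalize.
  exists (a - r *: z).
    apply: neg_convex_ball => //; first exact: nearest_bdry near.
    by apply: nearest_prox_normal; rewrite ?invr_ge0 ?ltW.
  (* The outside point lies at distance [d + r > r] from the centre [a - r z]. *)
  have -> : x = a + d *: z by rewrite scalerA divff ?gt_eqF// scale1r subrKC.
  have E : a + d *: z - (a - r *: z) = (d + r) *: z.
    by apply/rowP => i; rewrite !mxE; ring.
  rewrite /eclosed_ball /= E enormZ z1 mulr1 gtr0_norm ?addr_gt0//.
  by apply/negP; rewrite -ltNge ltrDr.
(* All balls of radius [r] containing [A] are taken; separating one outside point shows that there
   is at least one. *)
exists [set c | A `<=` eclosed_ball c r].
  by have [x /sep[c cA _]] := bounded_ex_notin A n1 Abd; exists c.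
apply/seteqP; split=> [a Aa c|x xC]; first exact.
by apply: contrapT => /sep[c /xC].
Qed.

End Euclidean.

Theorem theorem1p4 (R : realType) (n : nat) (A : set 'rV[R]_n) (r : R)
    (n_ge1 : (1 <= n)%N) (A_neq0 : A !=set0) (A_closed : closed A)
    (r_gt0 : 0 < r) :
  strongly_convex r A <->
  [/\ convex_set A, bounded_set A & neg_convex r (excess_set r A) A].
Proof.
split=> [Asc|[_ Abd Anc]]; last exact: neg_convex_strongly_convex.
split; [exact: strongly_convex_convex Asc|exact: strongly_convex_bounded Asc|].
exact: strongly_convex_neg_convex.
Qed.
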